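(* Let $X,Y$ be Polish spaces and let $A\subseteq X\times Y$ be a Borel set which is $\mathrm{pot}(D_2(\mathbf{\Sigma}^0_1))$. The following conditions are equivalent: (i) $A$ is not $\mathrm{pot}(\mathbf{\Sigma}^0_1)$. (ii) There exist injective continuous functions $\phi:2^\omega\to X$ and $\psi:2^\omega\to Y$ such that $\Delta(2^\omega)=(\phi\times\psi)^{-1}(A)$ or $L_0=(\phi\times\psi)^{-1}(A)$.
   Context: $D_2(\mathbf{\Sigma}^0_1)$ is the class of differences of two open sets; $\mathbf{\Sigma}^0_1$ is the class of open sets. For Polish spaces $X,Y$, a Borel set $A\subseteq X\times Y$ and a class $\Gamma$ (here $\mathbf{\Sigma}^0_1$ or $D_2(\mathbf{\Sigma}^0_1)$), $A$ is $\mathrm{pot}(\Gamma)$ if there are zero-dimensional Polish topologies $\sigma$ on $X$ and $\tau$ on $Y$, finer than the original topologies, such that $A$, seen as a subset of $(X,\sigma)\times(Y,\tau)$, is in $\Gamma$. $\Delta(2^\omega)=\{(\alpha,\alpha):\alpha\in2^\omega\}$ and $L_0=\{(\alpha,\beta)\in2^\omega\times2^\omega:\alpha\leq_{\mathrm{lex}}\beta\}$, where $\leq_{\mathrm{lex}}$ is the lexicographic order. $\phi\times\psi$ is the map $(\alpha,\beta)\mapsto(\phi(\alpha),\psi(\beta))$. *)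

(* Defs.v *)
From mathcomp Require Import all_boot all_order all_algebra.
From mathcomp Require Import all_classical all_reals all_analysis.

Set Implicit Arguments.
Unset Strict Implicit.
Unset Printing Implicit Defensive.

Local Open Scope classical_set_scope.

Definition separable (T : topologicalType) : Prop :=
  exists2 D : set T, countable D & dense D.

(* [m] ranges over all the metric structures on the carrier of [T]; its
   topology is required to be the one of [T]. *)
Definition completely_metrizable (R : realType) (T : topologicalType) : Prop :=
  exists m : Metric R T,
    let M : metricType R := Metric.Pack m in
    (@open M : set (set T)) = @open T /\
    forall F : set_system M, ProperFilter F -> cauchy F ->
      exists x : M, F --> x.

(* The empty space is allowed. *)
Definition polish (R : realType) (T : topologicalType) : Prop :=
  separable T /\ completely_metrizable R T.

(* A basis of clopen sets. The library's [zero_dimensional] only asks that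
   points be separated by clopen sets, which is weaker for noncompact Polish
   spaces. *)
Definition has_clopen_basis (T : topologicalType) : Prop :=
  exists2 B : set (set T), basis B & B `<=` @clopen T.

Definition borel (T : topologicalType) (A : set T) : Prop :=
  <<s @open T >> A.

Definition boldclass := forall T : topologicalType, set (set T).

Definition Sigma01 : boldclass := fun T => @open T.

Definition D2_Sigma01 : boldclass := fun T =>
  [set A | exists U V : set T, [/\ open U, open V & A = U `\` V]].

(* [Topological X] is the type of topologies on the carrier of [X], and
   [Topological.Pack s] is that carrier equipped with the topology [s]. *)
Definition finer (X : topologicalType) (s : Topological X) : Prop :=
  (@open X : set (set X)) `<=` @open (Topological.Pack s).

Definition pot (R : realType) (G : boldclass) (X Y : topologicalType)
    (A : set (X * Y)) : Prop :=
  exists (s : Topological X) (t : Topological Y),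
    let Xs : topologicalType := Topological.Pack s in
    let Yt : topologicalType := Topological.Pack t in
    [/\ polish R Xs /\ has_clopen_basis Xs,
        polish R Yt /\ has_clopen_basis Yt,
        finer s, finer t &
        G (Xs * Yt)%type A].

Definition lexle (a b : cantor_space) : Prop :=
  a = b \/
  exists n : nat, [/\ forall i, (i < n)%N -> a i = b i, a n = false & b n = true].

Definition Delta : set (cantor_space * cantor_space) := diagonal.

Definition L0 : set (cantor_space * cantor_space) := [set p | lexle p.1 p.2].

Definition prod_fun (X X' Y Y' : Type) (f : X -> X') (g : Y -> Y')
  (p : X * Y) : X' * Y' := (f p.1, g p.2).

(* Main.v *)
From HB Require Import structures.
Require Import Defs.
From mathcomp Require Import all_boot all_order all_algebra.
From mathcomp Require Import all_classical all_reals all_analysis.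

(** The argument is elementary because of one remark: if a rectangle is contained
    in a closed set, so is its closure. Hence a closed set [F] of a product of
    two zero-dimensional Polish spaces that is a countable union of rectangles
    is a countable union of closed rectangles, and it is potentially open: the
    two topologies can be refined so that countably many closed sets become
    open ([polish_refinement], [rect_covered_pot_open]).

    A potentially open set [A] is a countable union of rectangles. If all
    [(phi a, psi a)] are in [A], while [(phi a, psi b)] and [(phi b, psi a)] are
    both in [A] only for [a = b], then two points of the diagonal cannot share a
    rectangle, and the Cantor space would be countable
    ([diagonal_not_pot_open]). The diagonal and the lexicographic order both
    have this property, which gives one direction.

    Conversely, let [A = U \ V] with [U] and [V] open for finer zero-dimensional
    Polish topologies. If [A] is not potentially open, some clopen box contained
    in [U] meets the complement of [V] in a closed set [F] that is not a
    countable union of rectangles ([D2_dichotomy]). Removing from [F] the boxes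
    where it is such a union leaves a nonempty core, and every nonempty
    relatively open part of the core contains two points [p] and [q] with
    [(q.1, p.2)] off [F] ([core_split]). A Cantor scheme of such points
    ([cantor_scheme]) gives continuous [phi] and [psi] with [(phi a, psi a)] in
    [F] and [(phi b, psi a)] off [F] for [a] before [b]. Whether [(phi a, psi b)]
    is in [F] can be decided uniformly: either [(p.1, q.2)] can always be
    required to be off [F] too, which yields the diagonal, or on some part of the
    core this is never possible, which yields the lexicographic order
    ([closed_dichotomy]). Injectivity of [phi] and [psi] is then automatic. *)

Set Implicit Arguments.
Unset Strict Implicit.
Unset Printing Implicit Defensive.

Import Order.TTheory GRing.Theory Num.Theory.
Local Open Scope classical_set_scope.

(** * Coverings by countably many closed rectangles *)

(** For closed [F], a rectangle contained in [F] has its closure contained in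
    [F], so asking the rectangles to be closed costs nothing; closedness is what
    makes them open after [polish_refinement]. *)
Definition rect_covered (X Y : topologicalType) (F S : set (X * Y)) : Prop :=
  exists (P : nat -> set X) (Q : nat -> set Y),
    [/\ forall n, closed (P n), forall n, closed (Q n),
        forall n, P n `*` Q n `<=` F & S `<=` \bigcup_n (P n `*` Q n)].

Lemma rect_covered_sub (X Y : topologicalType) (F F' S S' : set (X * Y)) :
  F' `<=` F -> S `<=` S' -> rect_covered F' S' -> rect_covered F S.
Proof.
move=> FF' SS' [P [Q [cP cQ PQF S'PQ]]]; exists P, Q.
split=> // [n|z /SS'/S'PQ//].
exact: subset_trans (PQF n) FF'.
Qed.

Lemma rect_covered0 (X Y : topologicalType) (F : set (X * Y)) : rect_covered F set0.
Proof.
by exists (fun=> set0), (fun=> set0); split=> [_|_|_ z []|z []]//; exact: closed0.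
Qed.

Lemma rect_covered_bigcup (I : countType) (X Y : topologicalType) (F : set (X * Y))
    (S : I -> set (X * Y)) :
  (forall i, rect_covered F (S i)) -> rect_covered F (\bigcup_i S i).
Proof.
move=> /choice[P] /choice[Q] PQ.
exists (fun n => oapp (fun p : I * nat => P p.1 p.2) set0 (unpickle n)).
exists (fun n => oapp (fun p : I * nat => Q p.1 p.2) set0 (unpickle n)).
split=> [n|n|n|z [i _]].
- by case: (unpickle n) => [[i k]|] /=; [case: (PQ i)|exact: closed0].
- by case: (unpickle n) => [[i k]|] /=; [case: (PQ i)|exact: closed0].
- by case: (unpickle n) => [[i k]|] /=; [case: (PQ i)|move=> z []].
- have [_ _ _ cov] := PQ i; move=> /cov[k _ ikz].
  by exists (pickle (i, k)) => //; rewrite pickleK.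
Qed.

Lemma rect_coveredU (X Y : topologicalType) (F S S' : set (X * Y)) :
  rect_covered F S -> rect_covered F S' -> rect_covered F (S `|` S').
Proof.
move=> FS FS'; have {FS FS'}: forall b : bool, rect_covered F (if b then S else S').
  by case.
move=> /rect_covered_bigcup; apply: rect_covered_sub => // z [Sz|Sz].
  by exists true.
by exists false.
Qed.

(** * Countable bases *)

(** A countable basis given as a sequence, which may repeat members and contain
    the empty set. *)
Definition enum_basis (T : topologicalType) (O : nat -> set T) : Prop :=
  (forall n, open (O n)) /\
  forall (U : set T) x, nbhs x U -> exists2 n, O n x & O n `<=` U.

Lemma small_pow (R : realType) (e : R) : (0 < e)%R -> exists n, (2^-1 ^+ n < e)%R.
Proof.
move=> e0; have := @near_infty_natSinv_expn_lt R (PosNum e0).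
by case=> n _ /(_ n (leqnn n)) /= ne; exists n; rewrite exprVn -div1r.
Qed.

Lemma enum_basis_countType (I : countType) (T : topologicalType) (O : I -> set T) :
  (forall i, open (O i)) ->
  (forall (U : set T) x, nbhs x U -> exists2 i, O i x & O i `<=` U) ->
  enum_basis (fun n => oapp O set0 (unpickle n)).
Proof.
move=> oO bO; split=> [n|U x /bO[i Oix OiU]].
  by case: (unpickle n) => [i|] /=; [exact: oO|exact: open0].
by exists (pickle i); rewrite pickleK.
Qed.

Lemma separable_metric_basis (R : realType) (M : metricType R) : separable M ->
  exists O : nat -> set M, enum_basis O.
Proof.
move=> [D /countable_injP[g gD] dD].
pose O (nk : nat * nat) : set M :=
  \bigcup_(d in [set d | D d /\ g d = nk.1]) (ball d (2^-1 ^+ nk.2 : R))°%R.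
eexists; apply: (@enum_basis_countType _ _ O) => [nk|U x /nbhs_ballP[e /= e0 eU]].
  by apply: bigcup_open => d _; exact: open_interior.
have [k ke] : exists k, (2^-1 ^+ k < e / 2)%R.
  by apply: small_pow; rewrite divr_gt0.
have k0 : (0 < 2^-1 ^+ k :> R)%R by rewrite exprn_gt0// invr_gt0.
have r0 : (0 < 2^-1 ^+ k.+1 :> R)%R by rewrite exprn_gt0// invr_gt0.
have rE : (2^-1 ^+ k = 2^-1 ^+ k.+1 + 2^-1 ^+ k.+1 :> R)%R.
  by rewrite exprSr -splitr.
have [|d [xd Dd]] := dD (ball x (2^-1 ^+ k.+1 : R)%R)° _ (open_interior _).
  by exists x; exact: nbhsx_ballx.
have {}xd : ball x (2^-1 ^+ k.+1 : R)%R d by exact: interior_subset xd.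
exists (g d, k).
  exists d => //=; apply/nbhs_ballP; exists (2^-1 ^+ k.+1)%R => //= y xy.
  by rewrite rE; apply: ball_triangle xy; exact: ball_sym.
move=> y [d' [Dd' /= gdd']] /interior_subset yd'.
have dd' : d' = d by apply: gD => //; rewrite inE.
apply: eU; rewrite dd' in yd'.
apply: (@ball_split _ _ d); last by apply: le_ball yd'; exact: ltW.
by apply: le_ball xd; rewrite (le_trans _ (ltW ke))// rE lerDl ltW.
Qed.

(** A metric structure compatible with the topology of [T] gives the carrier a
    second topological structure, not convertible to the given one;
    neighborhoods, closed sets and bases are transferred between the two. *)
Section SameTopology.
Variables (R : realType) (T : topologicalType) (m : Metric R T).
Local Notation M := (Metric.Pack m : metricType R).
Hypothesis openM : (@open M : set (set T)) = @open T.

Lemma metric_nbhs (x : T) : @nbhs T M x = @nbhs T T x.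
Proof.
have EM : @nbhs T M x = [set A : set T | exists2 B : set T,
    @open_nbhs M x B & B `<=` A] := @nbhsE M x.
have ET : @nbhs T T x = [set A : set T | exists2 B : set T,
    @open_nbhs T x B & B `<=` A] := @nbhsE T x.
by rewrite EM ET /open_nbhs openM.
Qed.

Lemma metric_closed (C : set T) : @closed M C <-> @closed T C.
Proof.
have eqo : @open M (~` C) = @open T (~` C).
  by rewrite -[RHS]/((@open T : set (set T)) _) -openM.
split=> cC; first by rewrite -(@openC T) -eqo (@openC M).
by rewrite -(@openC M) eqo (@openC T).
Qed.

Lemma metric_basis (O : nat -> set T) : @enum_basis M O <-> @enum_basis T O.
Proof.
have eqo B : @open M B = @open T B.
  by rewrite -[RHS]/((@open T : set (set T)) _) -openM.
split=> -[oO bO]; split=> [n|U x].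
- by rewrite -eqo.
- by rewrite -metric_nbhs; exact: bO.
- by rewrite eqo.
- by rewrite metric_nbhs; exact: bO.
Qed.

End SameTopology.

Lemma polish_basis (R : realType) (T : topologicalType) : polish R T ->
  exists O : nat -> set T, enum_basis O.
Proof.
move=> [[D cD dD] [m [openM _]]].
have [|O bO] := @separable_metric_basis R (Metric.Pack m).
  exists D => // U U0 oU; apply: dD => //.
  by rewrite -[open _]/((@open T : set (set T)) U) -openM.
by exists O; apply/(metric_basis openM).
Qed.

(** For each pair of members of the countable basis between which some clopen
    set can be interpolated, one such set is chosen. *)
Lemma clopen_basis (T : topologicalType) (O : nat -> set T) :
  enum_basis O -> has_clopen_basis T ->
  exists2 O' : nat -> set T, enum_basis O' & forall n, clopen (O' n).
Proof.
move=> [oO bO] [B [oB bB] cB].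
have /choice[W WP] : forall nm : nat * nat, exists W : set T, clopen W /\
    ((exists V, [/\ B V, O nm.1 `<=` V & V `<=` O nm.2]) ->
     O nm.1 `<=` W /\ W `<=` O nm.2).
  move=> nm; have [[V [BV nV Vm]]|no] :=
    pselect (exists V, [/\ B V, O nm.1 `<=` V & V `<=` O nm.2]).
    by exists V; split=> //; exact: cB.
  by exists set0; split=> [|/no//]; exact: clopen0.
exists (fun n => oapp W set0 (unpickle n)).
  apply: enum_basis_countType => [nm|U x /bO[k kx kU]].
- by case: (WP nm) => -[].
- have [V [BV Vx] Vk] := bB x (O k) (open_nbhs_nbhs (conj (oO k) kx)).
  have [n nx nV] := bO V x (open_nbhs_nbhs (conj (oB V BV) Vx)).
  have [_ [|nW Wk]] := WP (n, k); first by exists V.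
  by exists (n, k); [exact: nW|exact: subset_trans kU].
- by move=> n; case: (unpickle n) => [nm|] /=; [case: (WP nm)|exact: clopen0].
Qed.

Lemma basis_separable (T : topologicalType) (O : nat -> set T) :
  enum_basis O -> separable T.
Proof.
move=> [oO bO].
have [[x0 _]|T0] := pselect (exists x : T, True); last first.
  by exists set0 => // U [x Ux]; case: T0; exists x.
have /choice[d dO] : forall n, exists x, O n !=set0 -> O n x.
  by move=> n; have [[x nx]|n0] := pselect (O n !=set0); [exists x|exists x0].
exists (range d); first exact: card_image_le.
move=> U [x Ux] oU; have [n nx nU] := bO U x (open_nbhs_nbhs (conj oU Ux)).
by exists (d n); split; [apply: nU; apply: dO; exists x|exists n].
Qed.

(** * Cantor schemes for an open relation *)

Lemma cylinder_nbhs (a : cantor_space) (n : nat) :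
  nbhs a [set b : cantor_space | forall i, (i < n)%N -> b i = a i].
Proof.
elim: n => [|n IH]; first by apply: filterS filterT => b _ i.
have : nbhs a ((fun b : cantor_space => b n) @^-1` [set a n]).
  apply: (@proj_continuous nat (fun=> bool) n a).
  exact: discrete_set1.
apply: filterS2 IH => b IH bn i.
by rewrite ltnS leq_eqVlt => /predU1P[->|/IH].
Qed.

Definition ltlex (a b : cantor_space) : Prop :=
  exists n : nat, [/\ forall i, (i < n)%N -> a i = b i, a n = false & b n = true].

Lemma ltlex_total (a b : cantor_space) : a <> b -> ltlex a b \/ ltlex b a.
Proof.
move=> ab.
have exn : exists n, a n != b n.
  apply: contrapT => nn; apply: ab; apply: functional_extensionality_dep => n.
  by apply/eqP; apply: contrapT => abn; apply: nn; exists n; apply/negP.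
case: (ex_minnP exn) => n abn nmin.
have low i : (i < n)%N -> a i = b i.
  move=> i_n; apply/eqP; apply: contraTT i_n => abi.
  by rewrite -leqNgt nmin.
case an : (a n) abn; case bn : (b n) => // _; [right|left]; exists n; split=> //.
by move=> i /low.
Qed.

Section CantorScheme.
Local Open Scope ring_scope.
Variables (R : realType) (Z : pseudoMetricType R).
Hypothesis Zcomplete :
  forall F : set_system Z, ProperFilter F -> cauchy F -> exists x : Z, F --> x.
Variables (G : set Z) (H : set (Z * Z)).
(* A pair [(z, r)] stands for the ball of center [z] and radius [r]. The radii
   are doubled in [stepP] so that the limit of the centers, which is only known
   to be in the balls with doubled radius, still satisfies the separation. *)
Variable step : Z * R -> bool -> Z * R.
Hypothesis stepP : forall z r, G z -> 0 < r ->
  let c := step (z, r) in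
  (forall b, [/\ G (c b).1, 0 < (c b).2, (c b).2 <= r / 2 &
     ball (c b).1 ((c b).2 * 2) `<=` ball z r]) /\
  (forall p q, ball (c false).1 ((c false).2 * 2) p ->
     ball (c true).1 ((c true).2 * 2) q -> H (p, q)).
Variable z0 : Z.
Hypothesis Gz0 : G z0.

Fixpoint node (a : cantor_space) (n : nat) : Z * R :=
  if n is m.+1 then step (node a m) (a m) else (z0, 1).

Lemma node_ext a b n : (forall i, (i < n)%N -> a i = b i) -> node a n = node b n.
Proof.
elim: n => //= n IH ab; rewrite ab// IH// => i i_n.
by apply: ab; rewrite ltnS ltnW.
Qed.

Lemma node_good a n : G (node a n).1 /\ 0 < (node a n).2.
Proof.
elim: n => [|n [Gn rn]] //=.
by case: (node a n) Gn rn => z r /= Gz r0; have [/(_ (a n))[]] := stepP Gz r0.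
Qed.

Lemma node_small a n : (node a n).2 <= 2^-1 ^+ n.
Proof.
elim: n => //= n IH; have [] := node_good a n.
move: IH; case: (node a n) => z r /= IH Gz r0.
have [/(_ (a n))[_ _ le_ _] _] := stepP Gz r0.
by rewrite (le_trans le_)// exprSr ler_pM2r// invr_gt0.
Qed.

Lemma node_nested1 a n :
  ball (node a n.+1).1 ((node a n.+1).2 * 2) `<=` ball (node a n).1 (node a n).2.
Proof.
have [] := node_good a n; rewrite /=; case: (node a n) => z r /= Gz r0.
by have [/(_ (a n))[]] := stepP Gz r0.
Qed.

Lemma node_nested a n k :
  ball (node a (n + k)).1 (node a (n + k)).2 `<=` ball (node a n).1 (node a n).2.
Proof.
elim: k => [|k IH]; first by rewrite addn0.
apply: subset_trans IH; rewrite addnS; apply: subset_trans (@node_nested1 _ _).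
apply: le_ball; rewrite ler_peMr ?ler1n//.
by have [_ /ltW] := node_good a (n + k).+1.
Qed.

Lemma node_in a n m : (n <= m)%N -> ball (node a n).1 (node a n).2 (node a m).1.
Proof.
move=> nm; apply: (@node_nested a n (m - n)); rewrite subnKC//.
by apply: ballxx; case: (node_good a m).
Qed.

Lemma scheme_limit a : exists l : Z,
  closure G l /\ forall n, ball (node a n).1 ((node a n).2 * 2) l.
Proof.
pose F : set_system Z := (fun n => (node a n).1) @ \oo.
have small e : 0 < e -> exists n, (node a n).2 < e.
  move=> /small_pow[n ne]; exists n.
  exact: le_lt_trans (node_small a n) ne.
have FF : ProperFilter F by exact: fmap_proper_filter.
have [|l Fl] := Zcomplete FF.
  apply/cauchy_exP => e e0; have [n ne] := small e e0.
  exists (node a n).1; exists n => // m /= nm.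
  by apply: le_ball (node_in _ nm); exact: ltW.
exists l; split.
  move=> U Ul; have [n _ Fn] : F U by exact: Fl.
  by exists (node a n).1; split; [case: (node_good a n)|exact: (Fn n (leqnn n))].
move=> n; have r0 := (node_good a n).2.
have [m _ Fm] : F (ball l (node a n).2) by apply: Fl; exact: nbhsx_ballx.
have lm := Fm (maxn m n) (leq_maxl m n).
have nm := node_in a (leq_maxr m n).
by rewrite mulr_natr mulr2n; apply: ball_triangle nm _; exact: ball_sym.
Qed.

Lemma scheme_map : exists h : cantor_space -> Z, [/\ continuous h,
  forall a, closure G (h a) & forall a b, ltlex a b -> H (h a, h b)].
Proof.
have [h hP] := choice scheme_limit; exists h; split.
- move=> a U /= /nbhs_ballP[e e0 eU].
  have [n ne] : exists n, (node a n).2 * 2 < e / 2.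
    have [|n ne] := @small_pow R (e / 4); first by rewrite divr_gt0.
    exists n; rewrite -ltr_pdivlMr// -mulrA -invfM -natrM.
    exact: le_lt_trans (node_small a n) ne.
  apply: filterS (cylinder_nbhs a n) => b ba; apply: eU.
  have := (hP a).2 n; have := (hP b).2 n; rewrite (node_ext ba) => hb ha.
  apply: (@ball_splitr _ _ (node a n).1); apply: le_ball (ltW ne) _ _ => //.
- by move=> a; exact: (hP a).1.
- move=> a b [n [ab an bn]].
  have ha := (hP a).2 n.+1; have hb := (hP b).2 n.+1.
  move: ha hb; rewrite /= (node_ext ab) an bn.
  have [] := node_good b n; case: (node b n) => z r /= Gz r0.
  have [_ sep] := stepP Gz r0; exact: sep.
Qed.

End CantorScheme.

Local Open Scope ring_scope.

(** If every relatively open nonempty part of [G] contains a pair in the open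
    relation [H], then a dyadic tree of shrinking balls centered in [G] can be
    grown so that any two points of the balls below the two children of a node
    are related by [H], from left to right. The branches of the tree converge,
    and two branches are compared at the node where they split. *)
Lemma cantor_scheme (R : realType) (Z : pseudoMetricType R)
    (Zcomplete : forall F : set_system Z, ProperFilter F -> cauchy F ->
       exists x : Z, F --> x)
    (G : set Z) (H : set (Z * Z)) (openH : open H)
    (splitG : forall U : set Z, open U -> G `&` U !=set0 ->
       exists p q, [/\ (G `&` U) p, (G `&` U) q & H (p, q)]) :
  G !=set0 ->
  exists h : cantor_space -> Z, [/\ continuous h,
    forall a, closure G (h a) & forall a b, ltlex a b -> H (h a, h b)].
Proof.
move=> [z0 Gz0].
have /choice[step stepP] : forall zr : Z * R, exists c : bool -> Z * R,
  G zr.1 -> 0 < zr.2 ->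
  (forall b, [/\ G (c b).1, 0 < (c b).2, (c b).2 <= zr.2 / 2 &
     ball (c b).1 ((c b).2 * 2) `<=` ball zr.1 zr.2]) /\
  (forall p q, ball (c false).1 ((c false).2 * 2) p ->
     ball (c true).1 ((c true).2 * 2) q -> H (p, q)).
  move=> [z r] /=; have [[Gz r0]|bad] := pselect (G z /\ 0 < r); last first.
    by exists (fun=> (z, r)) => Gz r0; exfalso; apply: bad.
  have [|p [q [[Gp Up] [Gq Uq] Hpq]]] := splitG _ (open_interior (ball z r)).
    by exists z; split=> //; exact: nbhsx_ballx.
  have /nbhs_ballP[e1 /= e10 e1U] : nbhs p (ball z r) by exact: Up.
  have /nbhs_ballP[e2 /= e20 e2U] : nbhs q (ball z r) by exact: Uq.
  have /nbhs_ballP[e3 /= e30 e3U] : nbhs (p, q) H by exact: open_nbhs_nbhs.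
  pose e := Num.min r (Num.min e1 (Num.min e2 e3)) / 2.
  have e2E : e * 2 = Num.min r (Num.min e1 (Num.min e2 e3)) by rewrite divfK.
  exists (fun b => if b then (q, e) else (p, e)) => _ _; split=> [b|p' q' /=].
    have e0 : 0 < e by rewrite divr_gt0// !lt_min r0 e10 e20.
    have er : e <= r / 2 by rewrite ler_pM2r ?invr_gt0// ge_min lexx.
    by case: b; split=> //=; rewrite e2E;
      [apply: subset_trans e2U|apply: subset_trans e1U];
      apply: le_ball; rewrite !ge_min lexx ?orbT.
  rewrite e2E => pp' qq'; apply: e3U; split=> /=.
    by apply: le_ball pp'; rewrite !ge_min lexx ?orbT.
  by apply: le_ball qq'; rewrite !ge_min lexx ?orbT.
apply: (@scheme_map _ _ Zcomplete _ H step _ _ Gz0) => z r.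
exact: (stepP (z, r)).
Qed.

Local Close Scope ring_scope.

(** * The dichotomy for closed sets *)

Lemma closure_open_pair (Z : topologicalType) (G : set Z) (K : set (Z * Z)) p q :
  closure G p -> closure G q -> open K -> K (p, q) ->
  exists p' q', [/\ G p', G q' & K (p', q')].
Proof.
move=> Gp Gq oK Kpq.
have [[U V] /= [Up Vq] UVK] : nbhs (p, q) K by exact: open_nbhs_nbhs.
have [p' [Gp' Up']] := Gp _ Up; have [q' [Gq' Vq']] := Gq _ Vq.
by exists p', q'; split=> //; exact: UVK.
Qed.

Section Dichotomy.
Variables (R : realType) (M N : pseudoMetricType R).
Hypothesis Mcomplete : forall F : set_system M,
  ProperFilter F -> cauchy F -> exists x : M, F --> x.
Hypothesis Ncomplete : forall F : set_system N,
  ProperFilter F -> cauchy F -> exists x : N, F --> x.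
Variables (OM : nat -> set M) (ON : nat -> set N).
Hypotheses (bM : enum_basis OM) (bN : enum_basis ON).

Lemma prod_complete (F : set_system (M * N)) :
  ProperFilter F -> cauchy F -> exists z : M * N, F --> z.
Proof.
move=> FF Fc.
have [|x Fx] := @Mcomplete (fst @ F) (fmap_proper_filter _ _).
  apply/cauchy_exP => e e0; have /cauchyP/(_ e e0)[z Fz] := Fc.
  by exists z.1; apply: (@filterS _ F _ (ball z e)) Fz => w [].
have [|y Fy] := @Ncomplete (snd @ F) (fmap_proper_filter _ _).
  apply/cauchy_exP => e e0; have /cauchyP/(_ e e0)[z Fz] := Fc.
  by exists z.2; apply: (@filterS _ F _ (ball z e)) Fz => w [].
exists (x, y) => W [[U V] /= [Ux Vy] UVW].
have FU : F (fst @^-1` U) by exact: Fx.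
have FV : F (snd @^-1` V) by exact: Fy.
by apply: filterS2 FU FV => w Uw Vw; apply: UVW.
Qed.

Variable F : set (M * N).
Hypothesis closedF : closed F.

(** The part of [F] that remains after all the basic boxes in which [F] is
    countably covered by rectangles contained in [F] have been removed. *)
Definition core : set (M * N) := F `&`
  [set z | forall n m, OM n z.1 -> ON m z.2 ->
  ~ rect_covered F (F `&` (OM n `*` ON m))].

Lemma rect_covered_off_core : rect_covered F (F `\` core).
Proof.
pose S (nm : nat * nat) := [set w | rect_covered F (F `&` (OM nm.1 `*` ON nm.2)) /\
  (F `&` (OM nm.1 `*` ON nm.2)) w].
apply: (@rect_covered_sub _ _ _ F _ (\bigcup_nm S nm)) => //.
  move=> w [Fw ncw]; apply: contrapT => nS; apply: ncw; split=> // n m nw mw c.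
  by apply: nS; exists (n, m).
apply: rect_covered_bigcup => nm.
have [c|c] := pselect (rect_covered F (F `&` (OM nm.1 `*` ON nm.2))).
  by apply: rect_covered_sub c => // w [].
by apply: rect_covered_sub (rect_covered0 F) => // w [].
Qed.

(** A covering of the trace of the core on a basic box, together with the
    covering of what lies off the core, would put this box among the removed
    ones. *)
Lemma core_not_covered (U : set (M * N)) : open U -> core `&` U !=set0 ->
  ~ rect_covered F (core `&` U).
Proof.
move=> oU [z [[Fz cz] Uz]] cov.
have [[V W] /= [Vz Wz] VWU] : nbhs z U by exact: open_nbhs_nbhs.
have [n nz nV] := bM.2 _ _ Vz; have [m mz mW] := bN.2 _ _ Wz.
apply: (cz n m nz mz).
apply: rect_covered_sub (rect_coveredU cov rect_covered_off_core) => // w [Fw [nw mw]].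
have [cw|ncw] := pselect (core w); last by right.
by left; split=> //; apply: VWU; split; [exact: nV|exact: mW].
Qed.

(** If no such pair existed, the product of the two projections of the trace of
    the core would be contained in [F]; its closure would be a single rectangle
    covering this trace. *)
Lemma core_split (U : set (M * N)) : open U -> core `&` U !=set0 ->
  exists p q, [/\ (core `&` U) p, (core `&` U) q & ~ F (q.1, p.2)].
Proof.
move=> oU /(core_not_covered oU) nc; apply: contrapT => nsplit; apply: nc.
pose C := core `&` U.
exists (fun=> closure (fst @` C)), (fun=> closure (snd @` C)); split.
- by move=> _; exact: closed_closure.
- by move=> _; exact: closed_closure.
- move=> _ [x y] /= [Cx Cy]; apply: closedF => W [[V V'] /= [Vx V'y] VW].
  have [_ [[q Cq <-] Vq]] := Cx _ Vx; have [_ [[p Cp <-] V'p]] := Cy _ V'y.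
  exists (q.1, p.2); split; last exact: VW.
  by apply: contrapT => nF; apply: nsplit; exists p, q.
- by move=> z cz; exists 0 => //; split; apply: subset_closure; exists z.
Qed.

Lemma cross_open : open [set pq : (M * N) * (M * N) | ~ F (pq.2.1, pq.1.2)].
Proof.
have -> : [set pq : (M * N) * (M * N) | ~ F (pq.2.1, pq.1.2)] =
   (fun pq : (M * N) * (M * N) => (pq.2.1, pq.1.2)) @^-1` (~` F) by [].
apply: open_comp; last exact: closed_openC.
move=> pq _; apply: cvg_pair => /=.
  apply: cvg_comp; [exact: cvg_snd|exact: cvg_fst].
apply: cvg_comp; [exact: cvg_fst|exact: cvg_snd].
Qed.

Lemma straight_open : open [set pq : (M * N) * (M * N) | ~ F (pq.1.1, pq.2.2)].
Proof.
have -> : [set pq : (M * N) * (M * N) | ~ F (pq.1.1, pq.2.2)] =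
   (fun pq : (M * N) * (M * N) => (pq.1.1, pq.2.2)) @^-1` (~` F) by [].
apply: open_comp; last exact: closed_openC.
move=> pq _; apply: cvg_pair => /=.
  apply: cvg_comp; [exact: cvg_fst|exact: cvg_fst].
apply: cvg_comp; [exact: cvg_snd|exact: cvg_snd].
Qed.

(** Say that [p] and [q] in the core are separated in one direction if
    [(q.1, p.2)] is off [F], and in both directions if [(p.1, q.2)] is off [F]
    as well. Either pairs separated in both directions occur everywhere in the
    core, and a Cantor scheme yields a copy of the diagonal. Or there are none in
    some nonempty relatively open part; pairs separated in one direction still
    exist everywhere, a Cantor scheme for them inside this part makes
    [(phi b, psi a)] leave [F] for [a] before [b], and [(phi a, psi b)] has to
    stay in [F]. *)
Lemma closed_dichotomy : ~ rect_covered F F ->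
  exists (phi : cantor_space -> M) (psi : cantor_space -> N),
  [/\ continuous phi, continuous psi, forall a, F (phi a, psi a) &
     (forall a b, a <> b -> ~ F (phi a, psi b)) \/
     (forall a b, ltlex a b -> F (phi a, psi b) /\ ~ F (phi b, psi a))].
Proof.
move=> nF.
have core0 : core !=set0.
  apply/set0P/eqP => c0; apply: nF.
  by apply: rect_covered_sub rect_covered_off_core => // z Fz; split=> //; rewrite c0.
have clF (U : set (M * N)) : closure (core `&` U) `<=` F.
  move=> z cz; apply: closedF; apply: closure_subset cz.
  by move=> w [[]].
have [both|] := pselect (forall U : set (M * N), open U -> core `&` U !=set0 ->
  exists p q, [/\ (core `&` U) p, (core `&` U) q & ~ F (p.1, q.2) /\ ~ F (q.1, p.2)]).
  have [h [hc hG hH]] := cantor_scheme prod_complete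
    (openI straight_open cross_open) both core0.
  exists (fst \o h), (snd \o h); split.
  - by move=> a; apply: cvg_comp (hc a) _; exact: cvg_fst.
  - by move=> a; apply: cvg_comp (hc a) _; exact: cvg_snd.
  - move=> a; rewrite -surjective_pairing; apply: (clF setT).
    by rewrite setIT.
  - by left => a b /ltlex_total[/hH[]|/hH[]].
move=> /existsNP[U /not_implyP[oU /not_implyP[U0 total]]].
have [|h [hc hG hH]] :=
  cantor_scheme prod_complete (G := core `&` U) cross_open _ U0.
  move=> V oV; rewrite -setIA => UV0.
  exact: (core_split (openI oU oV)).
exists (fst \o h), (snd \o h); split.
- by move=> a; apply: cvg_comp (hc a) _; exact: cvg_fst.
- by move=> a; apply: cvg_comp (hc a) _; exact: cvg_snd.
- by move=> a; rewrite -surjective_pairing; exact: (clF U).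
- right => a b ab; split; last exact: hH.
  (* If [(phi a, psi b)] were off [F], then [h a] and [h b] would be separated
     in both directions; this open condition would pass to points of the core. *)
  apply: contrapT => nFab; apply: total.
  exact: (closure_open_pair (hG a) (hG b) (openI straight_open cross_open)
    (conj nFab (hH _ _ ab))).
Qed.

End Dichotomy.

(** * Refining a Polish topology by closed sets *)

(** A sequence of integer-valued functions, packed into one [f], is made
    continuous by adding to the distance the ultrametric that is [2 ^- n] when
    [n] is the first index at which the values differ. *)
Section Refinement.
Local Open Scope ring_scope.
Variables (R : realType) (M : metricType R) (f : M -> nat -> nat).

Definition first_diff (x y : M) : R :=
  if pselect (exists n, f x n != f y n) is left e then 2^-1 ^+ ex_minn e else 0.

Lemma first_diff_le x y n : (forall i, (i < n)%N -> f x i = f y i) ->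
  first_diff x y <= 2^-1 ^+ n.
Proof.
move=> xy; rewrite /first_diff; case: pselect => [e|_]; last first.
  by rewrite exprn_ge0// invr_ge0.
case: ex_minnP => m xym _; rewrite ler_wiXn2l ?invr_ge0 ?invf_le1 ?ler1n//.
by rewrite leqNgt; apply: contra xym => /xy ->.
Qed.

Lemma first_diff_ge x y n : f x n != f y n -> 2^-1 ^+ n <= first_diff x y.
Proof.
move=> xy; rewrite /first_diff; case: pselect => [e|[]]; last by exists n.
case: ex_minnP => m xym mmin; rewrite ler_wiXn2l ?invr_ge0 ?invf_le1 ?ler1n//.
exact: mmin.
Qed.

Lemma first_diff_lt x y n i : first_diff x y < 2^-1 ^+ n -> (i <= n)%N ->
  f x i = f y i.
Proof.
move=> xyn i_n; apply/eqP; apply: contraTT xyn => /first_diff_ge xyi.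
rewrite -leNgt (le_trans _ xyi)// ler_wiXn2l ?invr_ge0 ?invf_le1 ?ler1n//.
Qed.

Lemma first_diff_ge0 x y : 0 <= first_diff x y.
Proof.
by rewrite /first_diff; case: pselect => // e; rewrite exprn_ge0// invr_ge0.
Qed.

Lemma first_diff_ultra y x z :
  first_diff x z <= Num.max (first_diff x y) (first_diff y z).
Proof.
rewrite {1}/first_diff; case: pselect => [e|_]; last first.
  by rewrite le_max first_diff_ge0.
case: ex_minnP => n xz _; rewrite le_max.
have [xy|/first_diff_ge->//] := eqVneq (f x n) (f y n).
by rewrite [X in _ || X]first_diff_ge ?orbT// -xy.
Qed.

Lemma first_diff_sym x y : first_diff x y = first_diff y x.
Proof.
rewrite /first_diff; case: pselect => [e|ne]; case: pselect => [e'|ne'] //.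
- congr (_ ^+ _); by apply: eq_ex_minn => n; rewrite eq_sym.
- by case: ne'; case: e => n xy; exists n; rewrite eq_sym.
- by case: ne; case: e' => n xy; exists n; rewrite eq_sym.
Qed.

Definition rdist (x y : M) : R := Num.max (mdist x y) (first_diff x y).

Lemma rdistxx x : rdist x x = 0.
Proof.
rewrite /rdist mdistxx; apply/max_idPl; rewrite /first_diff.
by case: pselect => // -[n nn]; exfalso; move: nn; rewrite eqxx.
Qed.

Lemma rdist_positivity x y : rdist x y = 0 -> x = y.
Proof.
move=> xy; apply: mdist_positivity; apply/le_anti.
by rewrite mdist_ge0 andbT -xy /rdist le_max lexx.
Qed.

Lemma rdist_sym x y : rdist x y = rdist y x.
Proof. by rewrite /rdist metric_sym first_diff_sym. Qed.

Lemma rdist_triangle y x z : rdist x z <= rdist x y + rdist y z.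
Proof.
rewrite {1}/rdist ge_max; apply/andP; split.
  by rewrite (le_trans (metric_triangle x y z))// lerD// /rdist le_max lexx.
rewrite (le_trans (first_diff_ultra y x z))// ge_max; apply/andP; split.
  rewrite (@le_trans _ _ (rdist x y))// ?lerDl /rdist ?le_max ?lexx ?orbT//.
  by rewrite mdist_ge0.
rewrite (@le_trans _ _ (rdist y z))// ?lerDr /rdist ?le_max ?lexx ?orbT//.
by rewrite mdist_ge0.
Qed.

End Refinement.

(** An alias of the carrier of [M], on which the new metric structure can be
    canonical. *)
Definition refined (R : realType) (M : metricType R) (f : M -> nat -> nat) : Type := M.

HB.instance Definition _ (R : realType) (M : metricType R) (f : M -> nat -> nat) :=
  Choice.copy (refined f) M.

HB.instance Definition _ (R : realType) (M : metricType R) (f : M -> nat -> nat) :=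
  @isMetric.Build R (refined f) (@rdist R M f) (@rdistxx R M f)
    (@rdist_positivity R M f) (@rdist_sym R M f) (@rdist_triangle R M f).

Section RefinedTopology.
Local Open Scope ring_scope.
Variables (R : realType) (M : metricType R) (f : M -> nat -> nat).

Definition agree (n : nat) (x : M) : set M :=
  [set y | forall i, (i < n)%N -> f y i = f x i].

Lemma refined_ballE (x : refined f) e : ball x e = [set y : M | rdist f x y < e].
Proof. by rewrite ballEmdist. Qed.

Lemma refined_ball_sub (x : M) e : ball (x : refined f) e `<=` ball x e.
Proof.
by move=> y; rewrite refined_ballE ballEmdist/= /rdist gt_max => /andP[].
Qed.

Lemma refined_ball_agree (x : M) n : ball (x : refined f) (2^-1 ^+ n) `<=` agree n x.
Proof.
move=> y; rewrite refined_ballE/= /rdist gt_max => /andP[_ xy] i i_n.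
by rewrite (first_diff_lt xy)// ltnW.
Qed.

Lemma refined_nbhsP (x : M) (W : set M) : nbhs (x : refined f) W <->
  exists (V : set M) n, nbhs x V /\ V `&` agree n x `<=` W.
Proof.
split=> [/nbhs_ballP[e /= e0 eW]|[V [n [/nbhs_ballP[e /= e0 eV] VW]]]].
  have [n ne] := small_pow e0.
  exists (ball x e), n; split; first exact: nbhsx_ballx.
  move=> y [xy xyn]; apply: eW; rewrite refined_ballE/= /rdist gt_max.
  rewrite ballEmdist/= in xy; rewrite xy/= (le_lt_trans _ ne)// first_diff_le//.
  by move=> i /xyn.
apply/nbhs_ballP; exists (Num.min e (2^-1 ^+ n)) => /=.
  by rewrite lt_min e0 exprn_gt0// invr_gt0.
move=> y xy; apply: VW; split.
  apply/eV/refined_ball_sub; apply: le_ball xy; by rewrite ge_min lexx.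
by apply: refined_ball_agree; apply: le_ball xy; rewrite ge_min lexx orbT.
Qed.

Lemma refined_open (U : set M) : open U -> open (U : set (refined f)).
Proof.
rewrite !openE => oU x Ux; apply/refined_nbhsP; exists U, 0%N; split=> [|y []//].
exact: oU.
Qed.

Lemma refined_agree_open n x : open (agree n x : set (refined f)).
Proof.
rewrite openE => y xy; apply/refined_nbhsP; exists setT, n; split=> [|z [_ yz] i i_n].
  exact: filterT.
by rewrite yz// xy.
Qed.

Lemma refined_agree_closed n x : closed (agree n x : set (refined f)).
Proof.
rewrite -openC openE => y xy; apply/refined_nbhsP.
exists setT, n; split=> [|z [_ yz] xz]; first exact: filterT.
by apply: xy => i i_n; rewrite -yz// xz.
Qed.

(** A Cauchy filter for the new distance converges for the old one, and for each
    [n] it contains a fiber of the [n]-th function; the limit belongs to this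
    fiber because the fiber is closed for the old topology. *)
Lemma refined_complete :
  (forall F : set_system M, ProperFilter F -> cauchy F -> exists x : M, F --> x) ->
  (forall n k, closed [set x : M | f x n = k]) ->
  forall F : set_system (refined f), ProperFilter F -> cauchy F ->
    exists x : refined f, F --> x.
Proof.
move=> Mc fib F FF Fc.
have [|x Fx] := Mc F FF.
  apply/cauchy_exP => e e0; have /cauchyP/(_ e e0)[z Fz] := Fc.
  by exists z; apply: filterS Fz; exact: refined_ball_sub.
exists x => W /refined_nbhsP[V [n [Vx VW]]].
have FV : F V by exact: Fx.
have [|z Fz] := (iffLR (cauchyP F) Fc) (2^-1 ^+ n).
  by rewrite exprn_gt0// invr_gt0.
have {}Fz : F (agree n z) by apply: filterS Fz; exact: refined_ball_agree.
have xz i : (i < n)%N -> f x i = f z i.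
  move=> i_n; apply: fib => U Ux; have FU : F U by exact: Fx.
  have /filter_ex[y [Uy zy]] : F (U `&` agree n z) by exact: filterI.
  by exists y; split=> //; exact: zy.
apply: filterS2 FV Fz => y Vy zy; apply: VW; split=> // i i_n.
by rewrite zy// xz.
Qed.

End RefinedTopology.

(** A closed set [C] is the zero set of an integer-valued function whose fibers
    are all closed: off [C], take the successor of the first index of a basic
    clopen set that contains the point and misses [C]. *)
Section ClosedCode.
Variables (T : topologicalType) (O : nat -> set T) (C : set T).
Hypotheses (bO : enum_basis O) (clO : forall n, clopen (O n)) (closedC : closed C).

Definition outside (n : nat) : set T := [set x | O n x /\ O n `<=` ~` C].

Definition code (x : T) : nat :=
  if pselect (exists n, `[< outside n x >]) is left e then (ex_minn e).+1 else 0.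

Lemma code_eq0 x : code x = 0 <-> C x.
Proof.
rewrite /code; case: pselect => [e|ne]; split=> //.
- by by move=> Cx; exfalso; case: e => n /asboolP[nx nC]; exact: (nC x nx).
- move=> _; apply: contrapT => nCx; apply: ne.
  have [|n nx nC] := bO.2 (~` C) x; last by exists n; apply/asboolP.
  by apply: open_nbhs_nbhs; split=> //; exact: closed_openC.
Qed.

Lemma clopen_outside n : clopen (outside n).
Proof.
have [nC|nC] := pselect (O n `<=` ~` C).
  suff -> : outside n = O n by [].
  by apply/seteqP; split=> x // [].
suff -> : outside n = set0 by exact: clopen0.
by apply/seteqP; split=> x // [].
Qed.

Lemma code_fiber_closed k : closed [set x | code x = k].
Proof.
case: k => [|k].
  by have -> : [set x | code x = 0] = C by apply/seteqP; split=> x /code_eq0.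
have -> : [set x | code x = k.+1] =
    outside k `&` \bigcap_(j in [set j | (j < k)%N]) ~` outside j.
  apply/seteqP; split=> x /=; rewrite /code; case: pselect => [e|ne] //.
  - case: ex_minnP => n /asboolP nx nmin [<-]; split=> // j /= jn /asboolP/nmin.
    by rewrite leqNgt jn.
  - move=> [kx kmin]; congr _.+1; case: ex_minnP => n /asboolP nx nmin.
    apply/eqP; rewrite eqn_leq nmin ?andbT; last exact/asboolP.
    by rewrite leqNgt; apply/negP => /kmin.
  - by move=> [kx _]; case: ne; exists k; apply/asboolP.
apply: closedI; first by case: (clopen_outside k).
by apply: closed_bigI => j _; apply: open_closedC; case: (clopen_outside j).
Qed.

End ClosedCode.

(** The refinement for which the functions [code] of the sets [C n] become
    continuous; each [C n] is then open, as the fiber of zero. *)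
Lemma polish_refinement (R : realType) (X : topologicalType) (C : nat -> set X) :
  polish R X -> has_clopen_basis X -> (forall n, closed (C n)) ->
  exists s : Topological X, [/\ polish R (Topological.Pack s),
    has_clopen_basis (Topological.Pack s), finer s &
    forall n, @open (Topological.Pack s) (C n)].
Proof.
move=> polX clX closedC.
have [B0 bB0] := polish_basis polX.
have [B bB clB] := clopen_basis bB0 clX.
case: polX => _ [m [openM Mc]].
pose M : metricType R := Metric.Pack m.
have eqo (U : set X) : @open M U = @open X U.
  by rewrite -[RHS]/((@open X : set (set X)) U) -openM.
pose f : M -> nat -> nat := fun x n => code B (C n) x.
have nbhsP (x : X) (W : set X) : nbhs (x : refined f) W <->
    exists i n, [/\ B i x & B i `&` agree f n x `<=` W].
  split=> [/refined_nbhsP[V [n [Vx VW]]]|[i [n [ix iW]]]].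
    move: Vx; rewrite -[nbhs _ _]/(@nbhs X M x V) (metric_nbhs openM) => Vx.
    have [i ix iV] := bB.2 V x Vx; exists i, n; split=> // y [/iV Vy xy].
    exact: VW.
  apply/refined_nbhsP; exists (B i), n; split=> //.
  rewrite -[nbhs _ _]/(@nbhs X M x (B i)) (metric_nbhs openM).
  by apply: open_nbhs_nbhs; split=> //; exact: bB.1.
have fin (U : set X) : open U -> open (U : set (refined f)).
  by move=> oU; apply: refined_open; rewrite eqo.
exists (Topological.class (refined f)); split.
- split; last first.
    exists (Metric.class (refined f)); split=> //.
    have fibers n k : closed [set x : M | f x n = k].
      by apply/(metric_closed openM); exact: code_fiber_closed.
    move=> F FF Fc; have [x Fx] := @refined_complete R M f Mc fibers F FF Fc.
    by exists x.
  pose E (ik : nat * seq nat) : set (refined f) := B ik.1 `&`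
    [set y : X | forall j, (j < size ik.2)%N -> f y j = nth 0 ik.2 j].
  have E_agree i n (x : X) : E (i, mkseq (f x) n) = B i `&` agree f n x.
    apply/seteqP; split=> y [iy xy]; split=> //.
    - by move=> j jn; have := xy j; rewrite /= size_mkseq nth_mkseq//; exact.
    - by move=> j /=; rewrite size_mkseq => jn; rewrite nth_mkseq//; exact: xy.
  apply: (@basis_separable _ (fun n => oapp E set0 (unpickle n))).
  apply: enum_basis_countType => [ik|W x /nbhsP[i [n [ix iW]]]].
    rewrite openE => y [iy yk]; apply/nbhsP; exists ik.1, (size ik.2); split=> //.
    by move=> z [iz yz]; split=> // j jk; rewrite yz//; exact: yk.
  by exists (i, mkseq (f x) n); rewrite E_agree.
- exists [set W : set X | exists i n x, W = B i `&` agree f n x].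
    split=> [_ [i [n [x ->]]]|x W /nbhsP[i [n [ix iW]]]].
      apply: openI; last exact: refined_agree_open.
      by apply: fin; exact: bB.1.
    exists (B i `&` agree f n x) => //; split; last by split.
    by exists i, n, x.
  move=> _ [i [n [x ->]]]; apply: clopenI; last first.
    split; [exact: refined_agree_open|exact: (@refined_agree_closed R M f n x)].
  split; first by apply: fin; exact: bB.1.
  rewrite -openC; apply: fin; rewrite openC; exact: (clB i).2.
- by move=> U; exact: fin.
- move=> n; rewrite openE => x Cx; apply/refined_nbhsP.
  exists setT, n.+1; split; first exact: filterT.
  move=> y [_ /(_ n (ltnSn n))]; rewrite /f.
  rewrite (iffRL (code_eq0 bB (closedC n) x) Cx) => /code_eq0; exact.
Qed.

(** * Potentially open sets and reductions *)

Lemma polish_dichotomy (R : realType) (X Y : topologicalType)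
    (F : set (X * Y)) :
  polish R X -> polish R Y -> closed F -> ~ rect_covered F F ->
  exists (phi : cantor_space -> X) (psi : cantor_space -> Y),
  [/\ continuous phi, continuous psi, forall a, F (phi a, psi a) &
     (forall a b, a <> b -> ~ F (phi a, psi b)) \/
     (forall a b, ltlex a b -> F (phi a, psi b) /\ ~ F (phi b, psi a))].
Proof.
move=> polX polY clF nF.
have [B bB] := polish_basis polX; have [C bC] := polish_basis polY.
case: polX => _ [m [openM Mc]]; case: polY => _ [n [openN Nc]].
pose M : metricType R := Metric.Pack m; pose N : metricType R := Metric.Pack n.
have nbhsMN (p : X * Y) : @nbhs _ (M * N)%type p = @nbhs _ (X * Y)%type p.
  by rewrite /nbhs/= (metric_nbhs openM) (metric_nbhs openN).
have clFMN : @closed (M * N)%type F.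
  move=> p Fp; apply: clF => U Up; apply: Fp; by rewrite nbhsMN.
have nFMN : ~ @rect_covered M N F F.
  move=> [P [Q [cP cQ PQF FPQ]]]; apply: nF; exists P, Q; split=> // k.
  - exact/(metric_closed openM).
  - exact/(metric_closed openN).
have bBM : @enum_basis M B by apply/(metric_basis openM).
have bCN : @enum_basis N C by apply/(metric_basis openN).
have [phi [psi [cphi cpsi diag alt]]] := closed_dichotomy Mc Nc bBM bCN clFMN nFMN.
exists phi, psi; split=> //.
- by move=> a U; rewrite -(metric_nbhs openM); exact: cphi.
- by move=> a U; rewrite -(metric_nbhs openN); exact: cpsi.
Qed.

(** With [A = U \ V], the set [A] is the union, over the basic clopen
    boxes contained in [U], of the closed sets obtained by removing [V] from the
    box. One of them, [W nm], is not countably covered, and the reduction found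
    for it is a reduction of [A]: since the diagonal is mapped into the box, so
    is everything, and inside the box [A] and [W nm] agree. *)
Lemma D2_dichotomy (R : realType) (X Y : topologicalType) (A : set (X * Y)) :
  polish R X -> has_clopen_basis X -> polish R Y -> has_clopen_basis Y ->
  D2_Sigma01 A -> ~ rect_covered A A ->
  exists (phi : cantor_space -> X) (psi : cantor_space -> Y),
    [/\ injective phi, continuous phi, injective psi, continuous psi &
        Delta = prod_fun phi psi @^-1` A \/ L0 = prod_fun phi psi @^-1` A].
Proof.
move=> polX clX polY clY [U [V [oU oV AUV]]] nA.
have [B0 bB0] := polish_basis polX; have [B bB clB] := clopen_basis bB0 clX.
have [C0 bC0] := polish_basis polY; have [C bC clC] := clopen_basis bC0 clY.
pose box (nm : nat * nat) := B nm.1 `*` C nm.2.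
pose W nm := [set z | [/\ box nm `<=` U, box nm z & ~ V z]].
have WA nm : W nm `<=` A by rewrite AUV => z [+ zb nV]; move=> /(_ z zb).
have [nm nW] : exists nm, ~ rect_covered (W nm) (W nm).
  apply/existsNP => covW; apply: nA.
  have : rect_covered A (\bigcup_nm W nm).
    by apply: rect_covered_bigcup => nm; apply: rect_covered_sub (covW nm).
  apply: rect_covered_sub => // z; rewrite AUV => -[Uz nVz].
  have [[S T] /= [Sz Tz] STU] : nbhs z U by exact: open_nbhs_nbhs.
  have [n nz nS] := bB.2 _ _ Sz; have [m mz mT] := bC.2 _ _ Tz.
  exists (n, m) => //; split=> // w [nw mw]; apply: STU.
  by split; [exact: nS|exact: mT].
have clW : closed (W nm).
  have boxU : box nm `<=` U.
    apply: contrapT => nb; apply: nW; apply: rect_covered_sub (rect_covered0 (W nm)) => //.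
    by move=> z [].
  move=> z Wz; split=> //.
    split.
      apply: (clB nm.1).2 => S Sz.
      have /Wz[w [[_ [wB _] _] Sw]] : nbhs z (fst @^-1` S) by exact: cvg_fst.
      by exists w.1.
    apply: (clC nm.2).2 => S Sz.
    have /Wz[w [[_ [_ wC] _] Sw]] : nbhs z (snd @^-1` S) by exact: cvg_snd.
    by exists w.2.
  move=> Vz; have /Wz[w [[_ _ nVw] Vw]] : nbhs z V by exact: open_nbhs_nbhs.
  exact: nVw.
have [phi [psi [cphi cpsi diag alt]]] := polish_dichotomy polX polY clW nW.
have AW a b : A (phi a, psi b) <-> W nm (phi a, psi b).
  have [boxU [Ba _] _] := diag a; have [_ [_ Cb] _] := diag b.
  split=> [|/WA//]; rewrite AUV => -[_ nV]; split=> //.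
(* This makes both maps injective: equal values at [a] and [b] would turn
   one of the two points off the closed set into a point of the diagonal. *)
have off a b : a <> b -> ~ W nm (phi a, psi b) \/ ~ W nm (phi b, psi a).
  case: alt => [sep|sep] ab; first by left; exact: sep.
  by have [/sep[]|/sep[]] := ltlex_total ab; [right|left].
exists phi, psi; split=> //.
- move=> a b phiab; apply: contrapT => /off[]; [rewrite phiab|rewrite -phiab];
    exact; exact: diag.
- move=> a b psiab; apply: contrapT => /off[]; [rewrite -psiab|rewrite psiab];
    exact; exact: diag.
- case: alt => sep; [left|right]; apply/seteqP; split=> -[a b].
  + move=> ab; have {ab}-> : a = b := ab.
    exact: (WA nm _ (diag b)).
  + rewrite /prod_fun/= => /AW ab; apply: contrapT => nab.
    exact: (sep a b).
  + by move=> /= [ab|/sep[/AW]//]; have {ab}/= -> := ab; exact: (WA nm _ (diag b)).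
  + rewrite /prod_fun/= => /AW ab; have [->|nab] := pselect (a = b); first by left.
    right; have [//|/sep[_ /(_ ab)//]] := ltlex_total nab.
Qed.

Lemma rect_covered_pot_open (R : realType) (X Y : topologicalType)
    (A : set (X * Y)) :
  polish R X -> has_clopen_basis X -> polish R Y -> has_clopen_basis Y ->
  rect_covered A A -> pot R Sigma01 A.
Proof.
move=> polX clX polY clY [P [Q [cP cQ PQA APQ]]].
have [s [pols cls fins oP]] := polish_refinement polX clX cP.
have [t [polt clt fint oQ]] := polish_refinement polY clY cQ.
exists s, t; split=> //; rewrite /Sigma01 openE => z /APQ[n _ [Pz Qz]].
exists (P n, Q n); last exact: PQA.
split; apply: open_nbhs_nbhs; first by split; [exact: oP|exact: Pz].
by split; [exact: oQ|exact: Qz].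
Qed.

Lemma pot_finer (R : realType) (G : boldclass) (X Y : topologicalType)
    (s : Topological X) (t : Topological Y) (A : set (X * Y)) :
  finer s -> finer t ->
  @pot R G (Topological.Pack s) (Topological.Pack t) A -> pot R G A.
Proof.
move=> fs ft [s' [t' [ps pt fs' ft' GA]]]; exists s', t'; split=> //.
- by move=> U /fs/fs'.
- by move=> U /ft/ft'.
Qed.

Lemma finer_continuous (T X : topologicalType) (s : Topological X) (f : T -> X) :
  finer s -> continuous (f : T -> Topological.Pack s) -> continuous f.
Proof.
move=> fs cf a W; rewrite nbhsE => -[V [oV Va] VW].
apply: (filterS VW); apply: cf; apply: open_nbhs_nbhs.
by split; [exact: fs|exact: Va].
Qed.

Lemma ltlex_asym a b : ltlex a b -> ltlex b a -> False.
Proof.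
move=> [n [abn an bn]] [m [bam bm am]].
case: (ltngtP n m) => [nm|mn|nm].
- by have := bam n nm; rewrite an bn.
- by have := abn m mn; rewrite am bm.
- by move: bn; rewrite nm bm.
Qed.

Lemma cantor_not_countable (g : cantor_space -> nat) : ~ injective g.
Proof.
move=> gI.
(* Cantor's diagonal argument. *)
pose b : cantor_space := fun n => `[< exists a, g a = n /\ a n = false >].
case bg : (b (g b)).
  by have /asboolP[a [/gI -> ]] := bg; rewrite bg.
by move: (bg) => /negbT/asboolP; apply; exists b.
Qed.

(** If [A] were potentially open, each [(phi a, psi a)] would lie in a box from a
    countable family of boxes contained in [A]. Two points with the same box
    satisfy both premises of the antisymmetry, so they are equal, and the Cantor
    space would be countable. *)
Lemma diagonal_not_pot_open (R : realType) (X Y : topologicalType)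
    (A : set (X * Y)) (phi : cantor_space -> X) (psi : cantor_space -> Y) :
  (forall a, A (phi a, psi a)) ->
  (forall a b, A (phi a, psi b) -> A (phi b, psi a) -> a = b) ->
  ~ pot R Sigma01 A.
Proof.
move=> diag anti [s [t [[pols _] [polt _] _ _ oA]]].
have [B bB] := polish_basis pols; have [C bC] := polish_basis polt.
have /choice[g gP] : forall a, exists nm : nat * nat,
    [/\ B nm.1 (phi a), C nm.2 (psi a) & B nm.1 `*` C nm.2 `<=` A].
  move=> a; have [[S T] /= [Sz Tz] STA] :
    @nbhs _ (Topological.Pack s * Topological.Pack t)%type (phi a, psi a) A.
    by apply: open_nbhs_nbhs; split.
  have [n nz nS] := bB.2 _ _ Sz; have [m mz mT] := bC.2 _ _ Tz.
  exists (n, m); split=> // w [nw mw]; apply: STA.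
  by split; [exact: nS|exact: mT].
apply: (@cantor_not_countable (pickle \o g)) => a b /= /(pcan_inj pickleK) gab.
have [Ba Ca _] := gP a; have [Bb Cb sub] := gP b.
by apply: anti; apply: sub; split=> //=; rewrite -gab.
Qed.

Theorem mainTheorem6 (R : realType) (X Y : topologicalType)
    (polishX : polish R X) (polishY : polish R Y) (A : set (X * Y))
    (borelA : borel A) (potA : pot R D2_Sigma01 A) :
  ~ pot R Sigma01 A <->
  exists (phi : cantor_space -> X) (psi : cantor_space -> Y),
    [/\ injective phi, continuous phi, injective psi, continuous psi &
        Delta = prod_fun phi psi @^-1` A \/ L0 = prod_fun phi psi @^-1` A].
Proof.
split=> [nopen|[phi [psi [_ _ _ _ red]]]]; last first.
  apply: (@diagonal_not_pot_open R X Y A phi psi) => [a|a b Aab Aba].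
    case: red => red; rewrite -[A _]/((prod_fun phi psi @^-1` A) (a, a)) -red//.
    by left.
  case: red => red.
    by rewrite -[a = b]/(Delta (a, b)) red.
  have Lab : L0 (a, b) by rewrite red.
  have Lba : L0 (b, a) by rewrite red.
  case: Lab => [//|ab]; case: Lba => [/esym//|ba]; case: (ltlex_asym ab ba).
have [s [t [[pols cls] [polt clt] fins fint D2A]]] := potA.
have [|phi [psi [iphi cphi ipsi cpsi red]]] := D2_dichotomy pols cls polt clt D2A.
  move=> covA; apply: nopen; apply: (pot_finer fins fint).
  exact: rect_covered_pot_open.
exists phi, psi; split=> //.
- exact: finer_continuous cphi.
- exact: finer_continuous cpsi.
Qed.
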